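(* Let $\xi$ and $\eta$ be two independent random variables, where $\xi\sim Exp(1)$ and $\eta\sim\mathcal{N}(0,1)$ (standard normal). Then $Z=\xi\,\eta$ is M-indet.
   Context: $Exp(1)$ is the standard exponential distribution, with density $e^{-x}$ on $[0,\infty)$. A random variable $X$ with distribution function $F$ and moments $m_k=\mathbf{E}[X^k]$ (all finite) is called moment determinate (M-det) if $F$ is the only distribution having the moment sequence $\{m_k\}_{k=1}^\infty$; otherwise it is called moment indeterminate (M-indet). *)

(* Defs.v *)
From HB Require Import structures.
From mathcomp Require Import all_boot all_order all_algebra.
From mathcomp Require Import all_classical all_reals all_analysis.
From mathcomp Require Import measurable_realfun.

Set Implicit Arguments.
Unset Strict Implicit.
Unset Printing Implicit Defensive.
Import Order.TTheory GRing.Theory Num.Theory.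
Import numFieldNormedType.Exports.

Local Open Scope classical_set_scope.
Local Open Scope ring_scope.
Local Open Scope ereal_scope.

(** Laws are compared on measurable sets only: a library measure is a total
    function on [set R], unconstrained outside the sigma-algebra, so Leibniz
    equality of measures would be too strong. *)
Definition same_law {R : realType} (mu nu : set R -> \bar R) : Prop :=
  forall A : set R, measurable A -> mu A = nu A.

Definition independent_RVs {d : measure_display} {T : measurableType d}
    {R : realType} (P : probability T R) (X Y : {RV P >-> R}) : Prop :=
  forall A B : set R, measurable A -> measurable B ->
    P (X @^-1` A `&` Y @^-1` B) = P (X @^-1` A) * P (Y @^-1` B).

Definition finite_moments {d : measure_display} {T : measurableType d}
    {R : realType} (P : probability T R) (X : T -> R) : Prop :=
  forall k : nat, (0 < k)%N ->
    P.-integrable [set: T] (fun w => (X w ^+ k)%:E).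

Definition moment {d : measure_display} {T : measurableType d}
    {R : realType} (P : probability T R) (X : T -> R) (k : nat) : \bar R :=
  'E_P[(fun w => X w ^+ k)%R].

(** A competing distribution [nu] is a probability on the Borel line; its
    moments are those of the identity random variable under [nu]. *)
Definition M_det {d : measure_display} {T : measurableType d}
    {R : realType} (P : probability T R) (X : {RV P >-> R}) : Prop :=
  finite_moments P X /\
  forall nu : probability (measurableTypeR R) R,
    finite_moments nu id ->
    (forall k : nat, (0 < k)%N -> moment nu id k = moment P X k) ->
    same_law nu (distribution P X).

Definition M_indet {d : measure_display} {T : measurableType d}
    {R : realType} (P : probability T R) (X : {RV P >-> R}) : Prop :=
  finite_moments P X /\ ~ M_det X.

(* Main.v *)
Require Import Defs.
From HB Require Import structures.
From mathcomp Require Import all_boot all_order all_algebra.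
From mathcomp Require Import all_classical all_reals all_analysis.
From mathcomp Require Import measurable_realfun.
From mathcomp Require Import ring lra.

(** The competing law is found by perturbing the joint law of [xi] and [eta]
    instead of the law of [Z = xi * eta]. Put

      g = sgn(Z) * sin(3 * xi + 3/8 * eta^2),       dQ = (1 + g) dP.

    Since |g| <= 1 and E[g] = 0, [Q] is a probability, and the law of [Z] under
    [Q] is the competitor. Two facts are to be checked.

    The moments agree, that is E[g * Z^k] = 0 for all k ([twisted_moment_eq0]).
    For even k the integrand is odd in [eta], whose law is symmetric. For
    k = 2n+1, sgn(Z) * Z^k = xi^k * |eta|^k almost surely, so by independence
    the expectation is, up to a real factor, the imaginary part of

      int_0^oo x^k exp(-(1+3i)x) dx * int_0^oo y^k exp(-(1+3i/4) y^2/2) dy,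

    which is a real multiple of the imaginary part of
    ((1+3i)^2 * (1+3i/4))^-(n+1). The frequencies 3 and 3/4 are such that
    (1+3i)^2 * (1+3i/4) = -25/2 is real ([moment_cancellation]). Only the
    odd powers of y occur here, and those reduce to powers of u = y^2/2 against
    exp(-(1+3i/4)u): both factors are values of one elementary integral, taken
    after a change of variable, and satisfy the same recurrence in the exponent.

    The laws differ, because the expectation of sgn(Z) changes
    ([twisted_sign_gt0]):

      E[g * sgn(Z)] = E[sin(3 * xi + 3/8 * eta^2)]
                    = E[3 * cos(3/8 * eta^2) + sin(3/8 * eta^2)] / 10
                   >= E[3 - 3/2 * eta^2] / 10 = 3/20 > 0,

    by the inequality 3 cos u + sin u >= 3 - 4u for u >= 0. *)

Import Order.TTheory GRing.Theory Num.Theory.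
Import numFieldNormedType.Exports.

Set Implicit Arguments.
Unset Strict Implicit.
Unset Printing Implicit Defensive.

Local Open Scope classical_set_scope.
Local Open Scope ring_scope.

(** * Integration on the half-line *)

Section half_line.
Context {R : realType}.
Implicit Types (f F g b phi dphi : R -> R) (k n : nat).
Notation mu := (@lebesgue_measure R).

Lemma continuous_funM f g :
  continuous f -> continuous g -> continuous (fun x => f x * g x).
Proof. by move=> cf cg x; apply: (@continuousM _ R^o); [exact: cf|exact: cg]. Qed.

Lemma continuous_fun_cst (c : R) : continuous (fun _ : R => c).
Proof. by move=> x; exact: cst_continuous. Qed.

Lemma continuous_funD f g :
  continuous f -> continuous g -> continuous (fun x => f x + g x).
Proof. by move=> cf cg x; apply: (@continuousD _ R^o); [exact: cf|exact: cg]. Qed.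

Lemma continuous_fun_comp f g :
  continuous f -> continuous g -> continuous (fun x => g (f x)).
Proof. by move=> cf cg x; apply: continuous_comp; [exact: cf|exact: cg]. Qed.

Lemma continuous_measurable (D : set R) f :
  continuous f -> measurable_fun D f.
Proof. by move=> cf; apply: measurable_funTS; exact: continuous_measurable_fun. Qed.

(** The rate 1/2, instead of the rate 1 of the functions of interest, leaves room
    to absorb polynomial factors. *)
Definition exp_decay f := continuous f /\
  exists C, forall x, 0 <= x -> `|f x| <= C * expR (- (x / 2)).

Lemma exp_decayD f g :
  exp_decay f -> exp_decay g -> exp_decay (fun x => f x + g x).
Proof.
move=> [cf [C fC]] [cg [D gD]]; split.
  exact: continuous_funD.
exists (C + D) => x x0; rewrite mulrDl.
by rewrite (le_trans (ler_normD _ _))// lerD ?fC ?gD.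
Qed.

Lemma exp_decayM f b (D : R) : exp_decay f ->
  continuous b -> (forall x, 0 <= x -> `|b x| <= D) ->
  exp_decay (fun x => f x * b x).
Proof.
move=> [cf [C fC]] cb bD; split.
  exact: continuous_funM.
exists (C * D) => x x0; rewrite normrM mulrAC.
by apply: ler_pM => //; [exact: fC|exact: bD].
Qed.

Lemma exp_decayZ f (c : R) : exp_decay f -> exp_decay (fun x => f x * c).
Proof.
move=> df; apply: (@exp_decayM f (fun=> c) `|c|) => //.
exact: continuous_fun_cst.
Qed.

(** From y <= exp y at y = x / (2(k+1)), raised to the power k; the exponent
    kx / (2(k+1)) is at most x / 2. *)
Lemma expr_le_expR k (x : R) : 0 <= x ->
  x ^+ k <= (2 * k.+1%:R) ^+ k * expR (x / 2).
Proof.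
move=> x0; set m : R := 2 * k.+1%:R.
have m0 : 0 < m by rewrite mulr_gt0.
have -> : x ^+ k = m ^+ k * (x / m) ^+ k.
  by rewrite -exprMn mulrC divfK ?gt_eqF.
rewrite ler_wpM2l ?exprn_ge0 ?(ltW m0)//.
apply: (@le_trans _ _ (expR (x / m) ^+ k)).
  rewrite lerXn2r ?nnegrE ?divr_ge0 ?expR_ge0 ?(ltW m0)//.
  by apply: le_trans (expR_ge1Dx _); rewrite lerDr.
rewrite -expRM_natl ler_expR.
have -> : k%:R * (x / m) = x / 2 * (k%:R / k.+1%:R).
  by rewrite /m; field; rewrite ?pnatr_eq0.
rewrite ler_piMr ?divr_ge0// ler_pdivrMr// mul1r ler_nat//.
Qed.

Lemma continuous_expN : continuous (fun x : R => expR (- x)).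
Proof.
move=> x; apply: continuous_comp; last exact: continuous_expR.
by apply: (@continuousN _ R^o).
Qed.

Lemma exp_decay_pow k : exp_decay (fun x => x ^+ k * expR (- x)).
Proof.
split; first exact: continuous_funM (@exprn_continuous _ k) continuous_expN.
exists ((2 * k.+1%:R) ^+ k) => x x0.
rewrite ger0_norm ?mulr_ge0 ?exprn_ge0 ?expR_ge0//.
have -> : expR (- x) = expR (- (x / 2)) * expR (- (x / 2)).
  by rewrite -expRD; congr expR; lra.
rewrite mulrA ler_wpM2r ?expR_ge0//.
by rewrite expRN ler_pdivrMr ?expR_gt0// expr_le_expR.
Qed.

(** An increasing substitution u = phi x of the half-line onto itself; the two
    cases used are u = x, for the exponential law, and u = x^2/2, for odd powers
    against the normal law. *)
Record change_of_var phi dphi : Prop := ChangeOfVar {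
  cv_derive : forall x : R, is_derive x (1 : R) phi (dphi x) ;
  cv_cont : continuous dphi ;
  cv_ge0 : forall x : R, 0 <= x -> 0 <= dphi x ;
  cv_phi_ge0 : forall x : R, 0 <= x -> 0 <= phi x ;
  cv_0 : phi 0 = 0 ;
  cv_y : phi x @[x --> +oo] --> +oo }.

Lemma change_of_var_id : change_of_var id (fun=> 1).
Proof.
split=> //.
- by move=> x; exact: is_derive_id.
- by move=> x; exact: cst_continuous.
Qed.

Lemma change_of_var_sqr : change_of_var (fun x => x ^+ 2 / 2) id.
Proof.
split=> //.
- move=> x; apply: is_derive_eq; rewrite /GRing.scale/=; lra.
- by move=> x; exact: cvg_id.
- by move=> x x0; rewrite divr_ge0 ?exprn_ge0.
- by rewrite expr0n mul0r.
- apply/cvgryPge => A; near=> x.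
  have x1 : 1 <= x by near: x; apply: nbhs_pinfty_ge; exact: num_real.
  have x2 : 2 * A <= x by near: x; apply: nbhs_pinfty_ge; exact: num_real.
  nra.
Unshelve. all: by end_near. Qed.

Lemma cv_continuous phi dphi : change_of_var phi dphi -> continuous phi.
Proof.
move=> cv x; apply/differentiable_continuous/derivable1_diffP.
by have [] := cv_derive cv x.
Qed.

(** For a nonnegative derivative, convergence of the primitive gives both
    integrability and the value of the integral. *)
Lemma integral_FTC2y (f F : R -> R) (l : R) :
  continuous f -> (forall x : R, is_derive x (1 : R) F (f x)) ->
  (forall x, 0 <= x -> 0 <= f x) -> F x @[x --> +oo] --> l ->
  mu.-integrable `[0, +oo[ (EFin \o f) /\
  \int[mu]_(x in `[0, +oo[) f x = l - F 0.
Proof.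
move=> cf dF f0 Fl.
have mf : measurable_fun (`[0, +oo[ : set R) f by exact: continuous_measurable.
have E : (\int[mu]_(x in `[0%R, +oo[) (f x)%:E = l%:E - (F 0)%:E)%E.
  apply: ge0_continuous_FTC2y => //.
  - exact: continuous_subspaceT.
  - apply: cvg_at_right_filter; apply: differentiable_continuous.
    exact/derivable1_diffP.
  - by move=> x _; rewrite derive1E; exact: derive_val.
split; last by rewrite /Rintegral E.
apply/integrableP; split; first exact/measurable_EFinP.
have -> : (\int[mu]_(x in `[0%R, +oo[) `|(EFin \o f) x| =
           \int[mu]_(x in `[0%R, +oo[) (f x)%:E)%E.
  apply: eq_integral => x; rewrite inE/= in_itv/= andbT => x0.
  by rewrite ger0_norm ?f0.
by rewrite E -EFinB ltry.
Qed.

Section change_of_variable.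
Variables (phi dphi : R -> R).
Hypothesis cv : change_of_var phi dphi.

(** The function exp(-phi/2) * dphi has an explicit primitive, which makes it the
    integrable majorant of all the integrands below. *)
Lemma exp_half_FTC (C : R) : 0 <= C ->
  [/\ continuous (fun x => C * expR (- (phi x / 2)) * dphi x),
   (forall x : R, is_derive x (1 : R) (fun x => - (2 * C) * expR (- (phi x / 2)))
                            (C * expR (- (phi x / 2)) * dphi x)),
   (forall x, 0 <= x -> 0 <= C * expR (- (phi x / 2)) * dphi x) &
   - (2 * C) * expR (- (phi x / 2)) @[x --> +oo] --> (0:R)].
Proof.
move=> C0; split.
- apply: continuous_funM; last exact: (cv_cont cv).
  apply: continuous_funM; first exact: continuous_fun_cst.
  apply: continuous_fun_comp continuous_expN.
  apply: continuous_funM; last exact: continuous_fun_cst.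
  exact: (cv_continuous cv).
- move=> x; have := cv_derive cv x => d.
  apply: is_derive_eq; rewrite /GRing.scale/=; lra.
- move=> x x0; rewrite !mulr_ge0 ?expR_ge0//; exact: (cv_ge0 cv).
- rewrite -(mulr0 (- (2 * C))); apply: cvgM; first exact: cvg_cst.
  apply: (@cvg_comp _ _ _ (fun x => phi x / 2) (fun x => expR (- x)) _ (+oo)).
    by apply: gt0_cvgMly; [rewrite invr_gt0|exact: (cv_y cv)].
  exact: cvgr_expR.
Qed.

Lemma exp_decay_bound f : exp_decay f -> exists2 C, 0 <= C &
  forall x, 0 <= x -> `|f (phi x) * dphi x| <= C * expR (- (phi x / 2)) * dphi x.
Proof.
move=> [_ [C fC]]; exists `|C| => // x x0.
rewrite normrM (ger0_norm (cv_ge0 cv x0)) ler_wpM2r ?(cv_ge0 cv)//.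
rewrite (le_trans (fC _ (cv_phi_ge0 cv x0)))//.
by rewrite ler_wpM2r ?expR_ge0// ler_norm.
Qed.

Lemma continuous_cv f : continuous f -> continuous (fun x => f (phi x) * dphi x).
Proof.
move=> cf; apply: continuous_funM; last exact: (cv_cont cv).
exact: continuous_fun_comp (cv_continuous cv) cf.
Qed.

Lemma exp_decay_integrable f : exp_decay f ->
  mu.-integrable `[0, +oo[ (EFin \o (fun x => f (phi x) * dphi x)).
Proof.
move=> df; have [C C0 fC] := exp_decay_bound df.
have [cg dG g0 Gl] := exp_half_FTC C0.
have [ig _] := integral_FTC2y cg dG g0 Gl.
apply: le_integrable ig => //.
  apply/measurable_EFinP; apply: continuous_measurable; apply: continuous_cv.
  by case: df.
move=> x/=; rewrite in_itv/= andbT => x0.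
by rewrite lee_fin [leRHS]ger0_norm ?g0// fC.
Qed.

Lemma exp_decay_cvg0 F : exp_decay F -> F (phi x) @[x --> +oo] --> (0 : R).
Proof.
move=> [_ [C FC]].
suff F0 : F x @[x --> +oo] --> (0 : R) by exact: cvg_comp (cv_y cv) F0.
apply/norm_cvg0P.
apply: (squeeze_cvgr (f := fun=> 0) (h := fun x => C * expR (- (x / 2)))).
- near=> x; rewrite normr_ge0/=; apply: FC.
  by near: x; apply: nbhs_pinfty_ge; exact: num_real.
- exact: cvg_cst.
- rewrite -(mulr0 C); apply: cvgM; first exact: cvg_cst.
  apply: (@cvg_comp _ _ _ (fun x => x / 2) (fun x => expR (- x)) _ (+oo)).
    by apply: gt0_cvgMly; [rewrite invr_gt0|].
  exact: cvgr_expR.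
Unshelve. all: by end_near. Qed.

(** A derivative of arbitrary sign is made nonnegative by adding the majorant of
    [exp_half_FTC], whose primitive is known, and [integral_FTC2y] applies to the
    sum and to the majorant. The only boundary term comes from 0. *)
Lemma exp_decay_FTC f F : exp_decay f -> exp_decay F ->
  (forall x : R, is_derive x (1 : R) F (f x)) ->
  \int[mu]_(x in `[0, +oo[) (f (phi x) * dphi x) = - F 0.
Proof.
move=> df dF FE; have [C C0 fC] := exp_decay_bound df.
have [cg dG g0 Gl] := exp_half_FTC C0.
have [ig Eg] := integral_FTC2y cg dG g0 Gl.
set g := (fun x => C * expR (- (phi x / 2)) * dphi x) in cg dG g0 ig Eg.
set G := (fun x => - (2 * C) * expR (- (phi x / 2))) in dG Gl Eg.
have if_ := exp_decay_integrable df.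
have [|||| ifg Efg] := @integral_FTC2y (fun x => f (phi x) * dphi x + g x)
  (fun x => F (phi x) + G x) 0.
- apply: continuous_funD cg.
  by apply: continuous_cv; case: df.
- move=> x; apply: is_deriveD => //.
  have := cv_derive cv x => dphi_x.
  exact: (@is_derive1_comp _ F phi x).
- move=> x x0; rewrite -lerBlDr sub0r.
  by have := fC x x0; rewrite ler_norml => /andP[].
- by rewrite -(addr0 0); apply: cvgD; [exact: exp_decay_cvg0|].
have : \int[mu]_(x in `[0, +oo[) (f (phi x) * dphi x + g x) -
       \int[mu]_(x in `[0, +oo[) g x = - F 0.
  rewrite Efg Eg /G /= (cv_0 cv); ring.
by rewrite RintegralD// addrK.
Qed.

End change_of_variable.
End half_line.

(** * Moments of damped oscillations *)

Section trig_moments.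
Context {R : realType}.
Implicit Types (w : R) (k n : nat).
Notation mu := (@lebesgue_measure R).

(** Real part and, with [sin_term], minus the imaginary part of
    x^k * exp(-(1 + iw)x). *)
Definition cos_term w k (x : R) := x ^+ k * expR (- x) * cos (w * x).
Definition sin_term w k (x : R) := x ^+ k * expR (- x) * sin (w * x).

Lemma continuous_mulr_id w : continuous (fun x : R => w * x).
Proof.
by apply: continuous_funM; [exact: continuous_fun_cst|move=> x; exact: cvg_id].
Qed.

Lemma exp_decay_cos w k : exp_decay (cos_term w k).
Proof.
apply: (exp_decayM (D := 1) (exp_decay_pow k)).
- exact: continuous_fun_comp (@continuous_mulr_id w) (@continuous_cos R).
- by move=> x _; rewrite ler_norml cos_geN1 cos_le1.
Qed.

Lemma exp_decay_sin w k : exp_decay (sin_term w k).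
Proof.
apply: (exp_decayM (D := 1) (exp_decay_pow k)).
- exact: continuous_fun_comp (@continuous_mulr_id w) (@continuous_sin R).
- by move=> x _; rewrite ler_norml sin_geN1 sin_le1.
Qed.

Section change_of_variable.
Variables (phi dphi : R -> R).
Hypothesis cv : change_of_var phi dphi.

(** The integral of [f] over the half-line in the variable u = phi x. *)
Definition half_line_integral (f : R -> R) :=
  \int[mu]_(x in `[0, +oo[) (f (phi x) * dphi x).

Lemma half_line_integralD (f g : R -> R) : exp_decay f -> exp_decay g ->
  half_line_integral (fun x => f x + g x) =
  half_line_integral f + half_line_integral g.
Proof.
move=> df dg; rewrite /half_line_integral.
under eq_Rintegral do rewrite mulrDl.
rewrite RintegralD//; exact: (exp_decay_integrable cv).
Qed.

Lemma half_line_integralZ (f : R -> R) (c : R) : exp_decay f ->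
  half_line_integral (fun x => f x * c) = half_line_integral f * c.
Proof.
move=> df; rewrite /half_line_integral.
under eq_Rintegral do rewrite mulrAC.
rewrite RintegralZr//; exact: (exp_decay_integrable cv).
Qed.

Lemma half_line_FTC (f F : R -> R) : exp_decay f -> exp_decay F ->
  (forall x : R, is_derive x (1 : R) F (f x)) ->
  half_line_integral f = - F 0.
Proof. exact: exp_decay_FTC. Qed.

Definition cos_moment w k := half_line_integral (cos_term w k).
Definition sin_moment w k := half_line_integral (sin_term w k).

Let dpow k (x : R) : is_derive x (1 : R) (fun x => x ^+ k * expR (- x))
    (k%:R * (x ^+ k.-1 * expR (- x)) - x ^+ k * expR (- x)).
Proof.
have dX : is_derive x (1 : R) (fun x => x ^+ k) (k%:R * x ^+ k.-1).
  have -> : (fun x : R => x ^+ k) = (@id R) ^+ k.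
    by apply/funext => y; rewrite exprfctE.
  apply: is_derive_eq.
  by rewrite /GRing.scale/= mulr1.
apply: is_derive_eq; rewrite /GRing.scale/=; ring.
Qed.

Lemma is_derive_cos_term w k (x : R) :
  is_derive x (1 : R) (cos_term w k)
    (k%:R * cos_term w k.-1 x - cos_term w k x - w * sin_term w k x).
Proof.
have dc : is_derive x (1 : R) (fun x => cos (w * x)) (- sin (w * x) * w).
  by apply: is_derive_eq; rewrite /GRing.scale/=; ring.
rewrite /cos_term /sin_term.
apply: (is_derive_eq (is_deriveM (dpow k x) dc)); rewrite /GRing.scale/=; ring.
Qed.

Lemma is_derive_sin_term w k (x : R) :
  is_derive x (1 : R) (sin_term w k)
    (k%:R * sin_term w k.-1 x - sin_term w k x + w * cos_term w k x).
Proof.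
have dc : is_derive x (1 : R) (fun x => sin (w * x)) (cos (w * x) * w).
  by apply: is_derive_eq; rewrite /GRing.scale/=; ring.
rewrite /cos_term /sin_term.
apply: (is_derive_eq (is_deriveM (dpow k x) dc)); rewrite /GRing.scale/=; ring.
Qed.

(** Integration by parts; the boundary term survives only for k = 0. The
    predecessor k.-1 is harmless at k = 0, where its coefficient vanishes. *)
Lemma cos_moment_parts w k :
  cos_moment w k.-1 * k%:R - cos_moment w k - sin_moment w k * w = - (k == 0)%:R.
Proof.
have dc := exp_decay_cos w k; have ds := exp_decay_sin w k.
have dc' := exp_decay_cos w k.-1.
pose f x := cos_term w k.-1 x * k%:R
    + (cos_term w k x * -1 + sin_term w k x * - w).
have dF (x : R) : is_derive x (1 : R) (cos_term w k) (f x).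
  by apply: (is_derive_eq (is_derive_cos_term w k x)); rewrite /f; ring.
transitivity (half_line_integral f).
  rewrite half_line_integralD; last 2 first.
  - exact: exp_decayZ.
  - by apply: exp_decayD; exact: exp_decayZ.
  rewrite half_line_integralD; [|exact: exp_decayZ..].
  by rewrite !half_line_integralZ// /cos_moment /sin_moment; ring.
rewrite (half_line_FTC _ _ dF).
- by rewrite /cos_term mulr0 cos0 oppr0 expR0 expr0n; case: eqP; rewrite ?mulr1.
- by apply: exp_decayD; [|apply: exp_decayD]; exact: exp_decayZ.
- by [].
Qed.

Lemma sin_moment_parts w k :
  sin_moment w k.-1 * k%:R - sin_moment w k + cos_moment w k * w = 0.
Proof.
have dc := exp_decay_cos w k; have ds := exp_decay_sin w k.
have ds' := exp_decay_sin w k.-1.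
pose f x := sin_term w k.-1 x * k%:R
    + (sin_term w k x * -1 + cos_term w k x * w).
have dF (x : R) : is_derive x (1 : R) (sin_term w k) (f x).
  by apply: (is_derive_eq (is_derive_sin_term w k x)); rewrite /f; ring.
transitivity (half_line_integral f).
  rewrite half_line_integralD; last 2 first.
  - exact: exp_decayZ.
  - by apply: exp_decayD; exact: exp_decayZ.
  rewrite half_line_integralD; [|exact: exp_decayZ..].
  by rewrite !half_line_integralZ// /cos_moment /sin_moment; ring.
rewrite (half_line_FTC _ _ dF).
- by rewrite /sin_term mulr0 sin0 mulr0 oppr0.
- by apply: exp_decayD; [|apply: exp_decayD]; exact: exp_decayZ.
- by [].
Qed.

Let w1 w : 1 + w ^+ 2 != 0.
Proof. by rewrite gt_eqF// ltr_pwDl// sqr_ge0. Qed.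

Lemma cos_moment0 w : cos_moment w 0 = (1 + w ^+ 2)^-1.
Proof.
apply/(mulIf (w1 w)); rewrite mulVf//.
have hc := cos_moment_parts w 0; have hs := sin_moment_parts w 0.
rewrite !mulr0 ?eqxx in hc hs.
have sE : sin_moment w 0 = cos_moment w 0 * w by lra.
by rewrite sE mulr1n in hc; lra.
Qed.

Lemma sin_moment0 w : sin_moment w 0 = w / (1 + w ^+ 2).
Proof.
have := sin_moment_parts w 0; rewrite cos_moment0 mulr0; lra.
Qed.

(** Together with [sin_momentS]: the moment of order k+1 is that of order k
    multiplied by (k+1) / (1 + iw). The recurrence does not mention the
    substitution, so it serves the exponential and the normal law alike. *)
Lemma cos_momentS w k : cos_moment w k.+1 =
  k.+1%:R / (1 + w ^+ 2) * (cos_moment w k - w * sin_moment w k).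
Proof.
apply/(mulIf (w1 w)); rewrite [RHS]mulrAC divfK//.
have hc := cos_moment_parts w k.+1; have hs := sin_moment_parts w k.+1.
rewrite /= oppr0 in hc hs.
have sE : sin_moment w k.+1 = sin_moment w k * k.+1%:R + cos_moment w k.+1 * w by lra.
by rewrite sE in hc; lra.
Qed.

Lemma sin_momentS w k : sin_moment w k.+1 =
  k.+1%:R / (1 + w ^+ 2) * (sin_moment w k + w * cos_moment w k).
Proof.
apply/(mulIf (w1 w)); rewrite [RHS]mulrAC divfK//.
have hc := cos_moment_parts w k.+1; have hs := sin_moment_parts w k.+1.
rewrite /= oppr0 in hc hs.
have cE : cos_moment w k.+1 = cos_moment w k * k.+1%:R - sin_moment w k.+1 * w by lra.
by rewrite cE in hs; lra.
Qed.

End change_of_variable.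

(** The left-hand side is minus the imaginary part of the product of two complex
    moments. Raising n by one multiplies that product by a positive multiple of
    the inverse of (1 + iw)^2 * (1 + iv), a number that is real because its
    imaginary part is 2w - v(w^2 - 1) = 0. *)
Lemma moment_cancellation phi dphi psi dpsi w v n :
  change_of_var phi dphi -> change_of_var psi dpsi ->
  v * (w ^+ 2 - 1) = 2 * w ->
  cos_moment phi dphi w n.*2.+1 * sin_moment psi dpsi v n +
  sin_moment phi dphi w n.*2.+1 * cos_moment psi dpsi v n = 0.
Proof.
move=> cphi cpsi vw; elim: n => [|n IH].
  rewrite (cos_momentS cphi) (sin_momentS cphi) (cos_moment0 cphi) (sin_moment0 cphi).
  rewrite (cos_moment0 cpsi) (sin_moment0 cpsi).
  set D := (1 + w ^+ 2)^-1; set E := (1 + v ^+ 2)^-1.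
  rewrite (_ : _ + _ = D ^+ 2 * E * (2 * w - v * (w ^+ 2 - 1))).
    by rewrite vw subrr mulr0.
  by rewrite double0; ring.
rewrite doubleS.
rewrite (cos_momentS cphi _ n.*2.+2) (sin_momentS cphi _ n.*2.+2).
rewrite (cos_momentS cphi _ n.*2.+1) (sin_momentS cphi _ n.*2.+1).
rewrite (cos_momentS cpsi) (sin_momentS cpsi).
set c := cos_moment _ _ w _ in IH *; set s := sin_moment _ _ w _ in IH *.
set c' := cos_moment _ _ v _ in IH *; set s' := sin_moment _ _ v _ in IH *.
set D := (1 + w ^+ 2)^-1; set E := (1 + v ^+ 2)^-1.
set a := n.*2.+3%:R; set b := n.*2.+2%:R; set e := n.+1%:R.
rewrite (_ : _ + _ = a * b * e * D ^+ 2 * E *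
    ((1 - w ^+ 2 - 2 * w * v) * (c * s' + s * c') +
     (2 * w - v * (w ^+ 2 - 1)) * (c * c' - s * s'))); last by ring.
by rewrite IH vw subrr mul0r !mulr0 addr0 mulr0.
Qed.

End trig_moments.

(** * Densities, reflection and independence *)

Section density.
Context d (T : measurableType d) (R : realType).
Variables (mu : {sigma_finite_measure set T -> \bar R})
          (nu : {finite_measure set T -> \bar R}) (p : T -> R).
Hypotheses (mp : measurable_fun setT p) (p0 : forall x, 0 <= p x).
Hypothesis nuE : forall A, measurable A -> nu A = (\int[mu]_(x in A) (p x)%:E)%E.

Let mpE : measurable_fun setT (EFin \o p).
Proof. exact/measurable_EFinP. Qed.

Let numu : nu `<< mu.
Proof.
apply/null_content_dominatesP => A mA A0; rewrite nuE//.
by apply: null_set_integral => //; exact: measurable_funTS.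
Qed.

Local Notation rn := (Radon_Nikodym_SigmaFinite.f nu mu).

Let rnE : ae_eq mu setT rn (EFin \o p).
Proof.
apply: integral_ae_eq => //; first exact: Radon_Nikodym_SigmaFinite.f_integrable.
by move=> A _ mA; rewrite -Radon_Nikodym_SigmaFinite.f_integral// nuE.
Qed.

(** The density [p] agrees almost everywhere with the Radon-Nikodym derivative, for
    which the formula is known. *)
Lemma ge0_integral_density (f : T -> \bar R) :
  measurable_fun setT f -> (forall x, 0 <= f x)%E ->
  (\int[nu]_x f x = \int[mu]_x (f x * (p x)%:E))%E.
Proof.
move=> mf f0; rewrite -(Radon_Nikodym_SigmaFinite.change_of_variables numu f0)//.
have mrn : measurable_fun setT rn.
  exact: measurable_int (Radon_Nikodym_SigmaFinite.f_integrable numu).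
apply: ae_eq_integral => //.
- exact: emeasurable_funM.
- exact: emeasurable_funM.
- exact: (@ae_eqe_mul2l _ _ _ _ _ _ _ f rnE).
Qed.

Lemma integral_density (f : T -> \bar R) : measurable_fun setT f ->
  (\int[nu]_x f x = \int[mu]_x (f x * (p x)%:E))%E.
Proof.
move=> mf; rewrite integralE [RHS]integralE.
rewrite ge0_integral_density ?ge0_integral_density//.
- congr (_ - _)%E; apply: eq_integral => x _.
    by rewrite !funeposE maxe_pMl ?lee_fin// mul0e.
  by rewrite !funenegE maxe_pMl ?lee_fin// mul0e mulNe.
- exact: measurable_funeneg.
- exact: measurable_funepos.
Qed.

Lemma integrable_density (f : T -> R) : measurable_fun setT f ->
  mu.-integrable setT (EFin \o (fun x => f x * p x)) ->
  nu.-integrable setT (EFin \o f).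
Proof.
move=> mf /integrableP[_ ifp]; apply/integrableP; split.
  exact/measurable_EFinP.
rewrite ge0_integral_density//; last first.
  by apply: measurableT_comp => //; exact/measurable_EFinP.
apply: le_lt_trans ifp; rewrite le_eqVlt; apply/orP; left; apply/eqP.
by apply: eq_integral => x _ /=; rewrite normrM (ger0_norm (p0 x)).
Qed.

Lemma Rintegral_density (f : T -> R) : measurable_fun setT f ->
  \int[nu]_x f x = \int[mu]_x (f x * p x).
Proof.
by move=> mf; rewrite /Rintegral integral_density//; exact/measurable_EFinP.
Qed.

End density.

Section reflection.
Context {R : realType}.
Notation mu := (@lebesgue_measure R).

(** It suffices to compare the two measures on half-open intervals. *)
Lemma lebesgue_measure_opp (A : set R) : measurable A ->
  mu A = pushforward mu (-%R : R -> R) A.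
Proof.
have mN : measurable_fun [set: measurableTypeR R]
    (-%R : measurableTypeR R -> measurableTypeR R) by exact: oppr_measurable.
move=> mA.
pose m : {measure set (measurableTypeR R) -> \bar R} :=
  measure_function_pushforward__canonical__measure_function_Measure mu mN.
apply: (@lebesgue_measure_unique R m) => // _ [[a b] _ <-] /=.
rewrite /pushforward.
have -> : -%R @^-1` `]a, b]%classic = `[- b, - a[%classic :> set R.
  apply/seteqP; split => x /=; rewrite !in_itv/= => /andP[h1 h2]; apply/andP; split; lra.
rewrite !lebesgue_measure_itv/= !lte_fin ltrN2; case: ifP => // _.
by rewrite -!EFinB opprK addrC.
Qed.

Lemma integral_opp_itv (h : R -> \bar R) : measurable_fun setT h ->
  (\int[mu]_(x in `]-oo, 0%R[) h x = \int[mu]_(x in `]0%R, +oo[) h (- x)%R)%E.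
Proof.
move=> mh.
have mN : measurable_fun [set: measurableTypeR R]
    (-%R : measurableTypeR R -> measurableTypeR R) by exact: oppr_measurable.
pose m : {measure set (measurableTypeR R) -> \bar R} :=
  measure_function_pushforward__canonical__measure_function_Measure mu mN.
have H (g : R -> \bar R) : measurable_fun setT g -> (forall x, 0 <= g x)%E ->
  (\int[mu]_(x in `]-oo, 0%R[) g x = \int[mu]_(x in `]0%R, +oo[) g (- x)%R)%E.
  move=> mg g0.
  rewrite (eq_measure_integral m); last first.
    by move=> A mA _; exact: lebesgue_measure_opp.
  rewrite ge0_integral_pushforward//; last exact: measurable_funTS.
  congr (integral _ _ _).
  by apply/seteqP; split => x /=; rewrite !in_itv/= ?andbT => ?; lra.
rewrite integralE [RHS]integralE; congr (_ - _)%E.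
- rewrite H//; last exact: measurable_funepos.
  by apply: eq_integral => x _; rewrite !funeposE.
- rewrite H//; last exact: measurable_funeneg.
  by apply: eq_integral => x _; rewrite !funenegE.
Qed.

(** Folding the line at 0 turns an integral against a symmetric density into one
    over the half-line, where odd parts cancel. *)
Lemma integral_fold (h : R -> R) : measurable_fun setT h ->
  mu.-integrable `]0, +oo[ (EFin \o h) ->
  mu.-integrable `]0, +oo[ (EFin \o (fun x => h (- x))) ->
  mu.-integrable setT (EFin \o h) /\
  \int[mu]_x h x = \int[mu]_(x in `]0, +oo[) (h x + h (- x)).
Proof.
move=> mh ih ihN.
have split_int (g : R -> \bar R) : measurable_fun setT g ->
    (\int[mu]_x g x = \int[mu]_(x in `]0%R, +oo[) g x +
                      \int[mu]_(x in `]0%R, +oo[) g (- x)%R)%E.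
  move=> mg; rewrite -integral_opp_itv// addeC.
  rewrite (@integral_itv_obnd_cbnd _ 0); last exact: measurable_funTS.
  have -> : [set: R] = `]-oo, 0%R[ `|` `[0%R, +oo[.
    by apply/seteqP; split => x //= _; rewrite !in_itv/= andbT; case: (ltP x 0); [left|right].
  rewrite integral_setU//; first exact: measurable_funTS.
  apply/disj_setPS => x [] /=; rewrite !in_itv/= andbT => h1 h2.
  by have := lt_le_trans h1 h2; rewrite ltxx.
have mEh : measurable_fun setT (EFin \o h) by exact/measurable_EFinP.
split.
  apply/integrableP; split => //.
  rewrite split_int; last exact: measurableT_comp.
  case/integrableP: ih => _ ih; case/integrableP: ihN => _ ihN.
  exact: lte_add_pinfty.
rewrite RintegralD// /Rintegral split_int// fineD//.
- exact: integrable_fin_num ih.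
- exact: integrable_fin_num ihN.
Qed.

End reflection.

Section independence.
Context d (T : measurableType d) (R : realType) (P : probability T R).
Variables X Y : {RV P >-> R}.
Hypothesis XY : independent_RVs X Y.

(** Independence says that the joint law of [X] and [Y] is the product of their
    laws; the rest is Fubini. *)
Lemma integral_indep (u v : R -> R) :
  measurable_fun setT u -> measurable_fun setT v ->
  P.-integrable setT (EFin \o (u \o X)) -> P.-integrable setT (EFin \o (v \o Y)) ->
  P.-integrable setT (EFin \o (fun t => u (X t) * v (Y t))) /\
  \int[P]_t (u (X t) * v (Y t)) = \int[P]_t u (X t) * \int[P]_t v (Y t).
Proof.
move=> mu_ mv iu iv.
pose XYf t := (X t, Y t).
have mXY : measurable_fun setT XYf by exact: measurable_fun_pair.
pose m1 := distribution P X; pose m2 := distribution P Y.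
pose m := measure_function_pushforward__canonical__measure_function_Measure P mXY.
have mE A : measurable A -> (m1 \x m2)%E A = m A.
  apply: product_measure_unique => B C mB mC; exact: XY.
pose f (z : R * R) := (u z.1 * v z.2)%:E.
have mf : measurable_fun setT f.
  apply/measurable_EFinP; apply: measurable_funM.
  - exact: measurableT_comp.
  - exact: measurableT_comp.
have mEu : measurable_fun setT (EFin \o u) by exact/measurable_EFinP.
have mEv : measurable_fun setT (EFin \o v) by exact/measurable_EFinP.
have iu' : m1.-integrable setT (EFin \o u).
  by apply: integrable_pushforward => //; rewrite preimage_setT.
have iv' : m2.-integrable setT (EFin \o v).
  by apply: integrable_pushforward => //; rewrite preimage_setT.
have int_f : (m1 \x m2)%E.-integrable setT f.
  (* By Tonelli the integral of |f| is the product of those of |u| and |v|. *)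
  apply/(integrable12ltyP _ _ mf).
  under eq_integral => x _.
    under eq_integral => y _ do rewrite /f /= normrM EFinM.
    rewrite ge0_integralZl//; last by apply: measurableT_comp => //; exact: measurableT_comp.
    over.
  rewrite ge0_integralZr//=.
  - case/integrableP : iu' => _ iu'; case/integrableP : iv' => _ iv'.
    apply: lte_mul_pinfty => //.
    + exact: integral_ge0.
    + apply/fin_numPlt; rewrite iu' andbT (lt_le_trans (ltNyr 0))//.
      exact: integral_ge0.
  - by apply/measurable_EFinP; apply: measurableT_comp.
  - exact: integral_ge0.
have iP : P.-integrable setT (f \o XYf).
  apply/integrableP; split; first exact: measurableT_comp.
  case/integrableP : int_f => _; apply: le_lt_trans.
  rewrite (eq_measure_integral m); last by move=> A mA _; exact: mE.
  by rewrite ge0_integral_pushforward//; exact: measurableT_comp.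
split; first exact: iP.
have fin1 := integrable_fin_num measurableT iu'.
have fin2 := integrable_fin_num measurableT iv'.
have E1 : (\int[m1]_x (u x)%:E = \int[P]_t (u (X t))%:E)%E.
  by rewrite [LHS]integral_pushforward.
have E2 : (\int[m2]_x (v x)%:E = \int[P]_t (v (Y t))%:E)%E.
  by rewrite [LHS]integral_pushforward.
rewrite /Rintegral -E1 -E2 -fineM//; congr fine.
transitivity (\int[m1 \x m2]_z f z)%E.
  rewrite (eq_measure_integral m); last by move=> A mA _; exact: mE.
  by rewrite [RHS]integral_pushforward.
rewrite -integral12_prod_meas1//.
under eq_integral => x _.
  rewrite /fubini_F /f /=.
  under eq_integral => y _ do rewrite EFinM.
  rewrite integralZl//.
  over.
rewrite -(fineK fin2) integralZr//.
Qed.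

End independence.

(** * Expectations under the exponential and normal laws *)

Section laws.
Context d (T : measurableType d) (R : realType) (P : probability T R).
Notation mu := (@lebesgue_measure R).

Lemma integral_RV_density (X : {RV P >-> R}) (p u : R -> R) :
  measurable_fun setT p -> (forall x, 0 <= p x) ->
  (forall A, measurable A -> distribution P X A = \int[mu]_(x in A) (p x)%:E)%E ->
  measurable_fun setT u ->
  mu.-integrable setT (EFin \o (fun x => u x * p x)) ->
  P.-integrable setT (EFin \o (u \o X)) /\
  \int[P]_t u (X t) = \int[mu]_x (u x * p x).
Proof.
move=> mp p0 XE mu_ iup.
have mEu : measurable_fun setT (EFin \o u) by exact/measurable_EFinP.
(* The Lebesgue measure lives on [measurableTypeR R], the line with the
   sigma-algebra generated by the half-open intervals. *)
have mX : @measurable_fun _ _ T (measurableTypeR R) setT X := measurable_funPT X.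
pose X' : {mfun T >-> measurableTypeR R} :=
  HB.pack (X : T -> measurableTypeR R) (isMeasurableFun.Build _ _ _ _ _ mX).
have iu : (distribution P X').-integrable setT (EFin \o u).
  exact: (@integrable_density _ _ _ mu (distribution P X') p).
have iuX : P.-integrable setT (EFin \o (u \o X)).
  apply/integrableP; split.
    by apply/measurable_EFinP; apply: measurableT_comp.
  case/integrableP : iu => _; rewrite ge0_integral_distribution//.
  exact: measurableT_comp.
split=> //.
rewrite -(@Rintegral_density _ _ _ mu (distribution P X') p)// /Rintegral.
by rewrite [in RHS]integral_distribution.
Qed.

(** The hypothesis on [u] constrains it on x > 0 only, so that sgn(x) may be
    replaced there by 1. *)
Lemma integral_exponential (X : {RV P >-> R}) (u f : R -> R) :
  same_law (distribution P X) (exponential_prob (1 : R)) ->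
  measurable_fun setT u -> exp_decay f ->
  (forall x, 0 < x -> u x * expR (- x) = f x) ->
  P.-integrable setT (EFin \o (u \o X)) /\
  \int[P]_t u (X t) = half_line_integral id (fun=> 1) f.
Proof.
move=> XE mu_ df uf.
have if_ := exp_decay_integrable change_of_var_id df.
have if' : mu.-integrable `]0, +oo[ (EFin \o (fun x => f x * 1)).
  apply: integrableS if_ => //.
  by apply: subset_itvr; rewrite bnd_simp.
have pE y : 0 < y -> exponential_pdf 1 y = expR (- y) :> R.
  by move=> y0; rewrite exponential_pdfE ?ltW// mul1r mulN1r.
have pN y : 0 < y -> exponential_pdf 1 (- y) = 0 :> R.
  by move=> y0; rewrite lt0_exponential_pdf// oppr_lt0.
have iup : mu.-integrable `]0, +oo[ (EFin \o (fun x => u x * exponential_pdf 1 x)).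
  apply: eq_integrable if' => // x; rewrite inE/= in_itv/= andbT => x0.
  by rewrite pE// uf// mulr1.
have iupN : mu.-integrable `]0, +oo[
    (EFin \o (fun x => u (- x) * exponential_pdf 1 (- x))).
  apply: eq_integrable (integrable0 _ _) => // x.
  by rewrite inE/= in_itv/= andbT => x0; rewrite pN// mulr0.
have mp := @measurable_exponential_pdf R 1.
have mup : measurable_fun setT (fun x => u x * exponential_pdf 1 x).
  exact: measurable_funM.
have [i1 E1] := integral_fold mup iup iupN.
have [i2 ->] := integral_RV_density mp (exponential_pdf_ge0 ler01) XE mu_ i1.
split=> //; rewrite E1 /half_line_integral -Rintegral_itv_obnd_cbnd//.
apply: eq_Rintegral => x; rewrite inE/= in_itv/= andbT => x0.
by rewrite pN// mulr0 addr0 mulr1 pE// uf.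
Qed.

(** For a function of parity [s] (1 if even, -1 if odd), folding doubles the
    half-line integral or cancels it. *)
Lemma integral_normal (X : {RV P >-> R}) (u h : R -> R) (s : R) :
  same_law (distribution P X) (normal_prob (0 : R) 1) ->
  measurable_fun setT u ->
  mu.-integrable `]0, +oo[ (EFin \o h) ->
  (forall x, 0 < x -> u x * expR (- (x ^+ 2 / 2)) = h x) ->
  (forall x, 0 < x -> u (- x) = s * u x) ->
  P.-integrable setT (EFin \o (u \o X)) /\
  \int[P]_t u (X t) =
    normal_peak 1 * (1 + s) * \int[mu]_(x in `]0, +oo[) h x.
Proof.
move=> XE mu_ ih uh us.
have pE y : normal_pdf 0 1 y = normal_peak 1 * expR (- (y ^+ 2 / 2)) :> R.
  rewrite normal_pdfE ?oner_neq0// /normal_fun subr0 expr1n mulNr.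
  by [].
have pN y : normal_pdf 0 1 (- y) = normal_pdf 0 1 y :> R.
  by rewrite !pE sqrrN.
have iup : mu.-integrable `]0, +oo[ (EFin \o (fun x => u x * normal_pdf 0 1 x)).
  apply: eq_integrable (integrableZl _ (normal_peak 1) ih) => //.
  move=> x; rewrite inE/= in_itv/= andbT => x0.
  by rewrite -EFinM pE -uh// mulrCA.
have iupN : mu.-integrable `]0, +oo[
    (EFin \o (fun x => u (- x) * normal_pdf 0 1 (- x))).
  apply: eq_integrable (integrableZl _ s iup) => //.
  move=> x; rewrite inE/= in_itv/= andbT => x0.
  by rewrite -EFinM us// pN mulrA.
have mup : measurable_fun setT (fun x => u x * normal_pdf 0 1 x).
  by apply: measurable_funM => //; exact: measurable_normal_pdf.
have [i1 E1] := integral_fold mup iup iupN.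
have [i2 ->] := integral_RV_density (measurable_normal_pdf 0 1)
  (normal_pdf_ge0 0 1) XE mu_ i1.
split=> //; rewrite E1 -RintegralZl//.
apply: eq_Rintegral => x; rewrite inE/= in_itv/= andbT => x0.
by rewrite us// pN pE -uh//; ring.
Qed.

End laws.

(** * Signed monomials of an exponential or a normal variable *)

Section signed_moments.
Context {R : realType}.
Implicit Types (b : R -> R) (j k : nat).
Notation mu := (@lebesgue_measure R).

Lemma measurable_sgr : measurable_fun setT (Num.sg : R -> R).
Proof.
apply: nondecreasing_measurable => // x y xy.
case: (sgrP x) => [x0|x0|x0]; case: (sgrP y) => [y0|y0|y0]; lra.
Qed.

Lemma continuous_half_sqr : continuous (fun y : R => y ^+ 2 / 2).
Proof. exact: cv_continuous change_of_var_sqr. Qed.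

Lemma continuous_gauss : continuous (fun y : R => expR (- (y ^+ 2 / 2))).
Proof. exact: continuous_fun_comp continuous_half_sqr continuous_expN. Qed.

(** Comparison with exp(-y): by (y - 1)^2 >= 0, y - y^2/2 <= 1/2. *)
Lemma exp_decay_gauss k b : continuous b -> (forall y, `|b y| <= 1) ->
  exp_decay (fun y => y ^+ k * expR (- (y ^+ 2 / 2)) * b y).
Proof.
move=> cb b1.
have -> : (fun y => y ^+ k * expR (- (y ^+ 2 / 2)) * b y) =
    (fun y => y ^+ k * expR (- y) * (expR y * expR (- (y ^+ 2 / 2)) * b y)).
  apply/funext => y; rewrite !mulrA; congr (_ * _ * _).
  by rewrite mulrAC -!mulrA -expRD subrr expR0 mulr1.
apply: (exp_decayM (D := expR (1 / 2)) (exp_decay_pow k)).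
- apply: continuous_funM cb.
  exact: continuous_funM (@continuous_expR R) continuous_gauss.
- move=> y _; rewrite normrM ger0_norm ?mulr_ge0 ?expR_ge0//.
  rewrite -[leRHS]mulr1; apply: ler_pM => //.
  rewrite -expRD ler_expR.
  have := sqr_ge0 (y - 1); rewrite sqrrB; nra.
Qed.

(** The power [j] of the sign sets the parity: an odd [j] turns an odd power of x
    into the corresponding power of |x|. *)
Definition signed_monomial j k b (x : R) := Num.sg x ^+ j * x ^+ k * b x.

Lemma measurable_signed_monomial j k b :
  continuous b -> measurable_fun setT (signed_monomial j k b).
Proof.
move=> cb; apply: measurable_funM; last exact: continuous_measurable.
apply: measurable_funM; last exact: continuous_measurable (@exprn_continuous _ k).
exact: measurable_funX measurable_sgr.
Qed.

Lemma signed_monomial_gt0 j k b (x : R) : 0 < x ->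
  signed_monomial j k b x = x ^+ k * b x.
Proof. by move=> x0; rewrite /signed_monomial gtr0_sg// expr1n mul1r. Qed.

Context d (T : measurableType d) (P : probability T R).

Lemma exponential_moment (X : {RV P >-> R}) j k b :
  same_law (distribution P X) (exponential_prob (1 : R)) ->
  continuous b -> (forall y, `|b y| <= 1) ->
  P.-integrable setT (EFin \o (signed_monomial j k b \o X)) /\
  \int[P]_t signed_monomial j k b (X t) =
    half_line_integral id (fun=> 1) (fun x => x ^+ k * expR (- x) * b x).
Proof.
move=> XE cb b1; apply: integral_exponential => //.
- exact: measurable_signed_monomial.
- by apply: (exp_decayM (D := 1) (exp_decay_pow k)) => // x _; exact: b1.
- by move=> x x0; rewrite signed_monomial_gt0// mulrAC.
Qed.

Definition gauss_integral k b :=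
  half_line_integral id (fun=> 1) (fun y => y ^+ k * expR (- (y ^+ 2 / 2)) * b y).

Lemma normal_moment (X : {RV P >-> R}) j k b :
  same_law (distribution P X) (normal_prob (0 : R) 1) ->
  continuous b -> (forall y, `|b y| <= 1) -> (forall y, b (- y) = b y) ->
  P.-integrable setT (EFin \o (signed_monomial j k b \o X)) /\
  \int[P]_t signed_monomial j k b (X t) =
    normal_peak 1 * (1 + (-1) ^+ (j + k)) * gauss_integral k b.
Proof.
move=> XE cb b1 bN.
have dg := exp_decay_gauss k cb b1.
have ig := exp_decay_integrable change_of_var_id dg.
rewrite /gauss_integral /half_line_integral -Rintegral_itv_obnd_cbnd; last first.
  apply: integrableS ig => //.
  by apply: subset_itvr; rewrite bnd_simp.
apply: integral_normal => //.
- exact: measurable_signed_monomial.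
- apply: integrableS ig => //.
  by apply: subset_itvr; rewrite bnd_simp.
- by move=> x x0; rewrite signed_monomial_gt0// mulr1 mulrAC.
- move=> x x0; rewrite /signed_monomial sgrN bN (exprNn (Num.sg x)) (exprNn x) exprD; ring.
Qed.

(** Equality holds at 0, and the difference of the two sides has derivative
    cos x - 3 sin x + 4 >= 0. *)
Lemma trig_lower_bound (x : R) : 0 <= x -> 3 - 4 * x <= 3 * cos x + sin x.
Proof.
move=> x0.
pose F (y : R) := 3 * cos y + sin y + 4 * y.
have dF (y : R) : is_derive y (1 : R) F (- 3 * sin y + cos y + 4).
  by rewrite /F; apply: is_derive_eq; rewrite /GRing.scale/=; ring.
have cF : {within `[0, x], continuous F}.
  apply: continuous_subspaceT => y; apply: differentiable_continuous.
  exact/derivable1_diffP.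
have [c _ E] := MVT_segment x0 (fun y _ => dF y) cF.
have : 0 <= F x - F 0.
  rewrite E subr0; apply: mulr_ge0 => /=; last exact: x0.
  have := sin_le1 c; have := cos_geN1 c.
  lra.
by rewrite /F cos0 sin0; lra.
Qed.

End signed_moments.

(** * Gaussian integrals *)

Section gauss.
Context {R : realType}.
Implicit Types (v : R) (k n : nat).
Notation mu := (@lebesgue_measure R).

Definition cos_sqr v (y : R) := cos (v * (y ^+ 2 / 2)).
Definition sin_sqr v (y : R) := sin (v * (y ^+ 2 / 2)).

Lemma continuous_cos_sqr v : continuous (cos_sqr v).
Proof.
apply: continuous_fun_comp (@continuous_cos R).
exact: continuous_fun_comp continuous_half_sqr (@continuous_mulr_id _ v).
Qed.

Lemma continuous_sin_sqr v : continuous (sin_sqr v).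
Proof.
apply: continuous_fun_comp (@continuous_sin R).
exact: continuous_fun_comp continuous_half_sqr (@continuous_mulr_id _ v).
Qed.

(** For odd powers the substitution u = y^2/2 is exact, since
    y^(2n+1) dy = 2^n * u^n du. *)
Lemma gauss_integral_cos v n :
  gauss_integral n.*2.+1 (cos_sqr v) = 2 ^+ n * cos_moment (fun y => y ^+ 2 / 2) id v n.
Proof.
rewrite /cos_moment /half_line_integral -RintegralZl//; last first.
  exact: (exp_decay_integrable change_of_var_sqr (exp_decay_cos v n)).
apply: eq_Rintegral => y _; rewrite mulr1 /cos_term /cos_sqr exprS.
rewrite -mul2n exprM expr_div_n; field.
by rewrite expf_neq0.
Qed.

Lemma gauss_integral_sin v n :
  gauss_integral n.*2.+1 (sin_sqr v) = 2 ^+ n * sin_moment (fun y => y ^+ 2 / 2) id v n.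
Proof.
rewrite /sin_moment /half_line_integral -RintegralZl//; last first.
  exact: (exp_decay_integrable change_of_var_sqr (exp_decay_sin v n)).
apply: eq_Rintegral => y _; rewrite mulr1 /sin_term /sin_sqr exprS.
rewrite -mul2n exprM expr_div_n; field.
by rewrite expf_neq0.
Qed.

(** By [trig_lower_bound] at u = 3/8 * y^2, the combination of the cosine and
    the sine is at least 3 - 3/2 * y^2 = 3/2 + 3/2 * (1 - y^2); the second summand
    integrates to 0 against exp(-y^2/2), being then the derivative of
    y * exp(-y^2/2) up to a factor. *)
Lemma gauss_integral_lower_bound :
  3 / 2 * gauss_integral 0 (fun=> 1) <=
  3 * gauss_integral 0 (cos_sqr (3 / 4)) + gauss_integral 0 (sin_sqr (3 / 4)) :> R.
Proof.
have cv := @change_of_var_id R.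
have c1 : continuous (fun _ : R => 1 : R) by exact: continuous_fun_cst.
have b1 (y : R) : `|1 : R| <= 1 by rewrite normr1.
have d0 := exp_decay_gauss 0 c1 b1.
have d1 := exp_decay_gauss 1 c1 b1.
have d2 := exp_decay_gauss 2 c1 b1.
have dc := exp_decay_gauss 0 (@continuous_cos_sqr (3 / 4)) (fun y => cos_max _).
have ds := exp_decay_gauss 0 (@continuous_sin_sqr (3 / 4)) (fun y => sin_max _).
pose e k (y : R) := y ^+ k * expR (- (y ^+ 2 / 2)) * 1.
have dF (y : R) : is_derive y (1 : R) (e 1%N) (e 0%N y + e 2%N y * -1).
  by rewrite /e; apply: is_derive_eq; rewrite /GRing.scale/=; field.
have dh : exp_decay (fun y => e 0%N y + e 2%N y * -1).
  by apply: exp_decayD => //; exact: exp_decayZ.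
have E0 : half_line_integral id (fun=> 1) (fun y => e 0%N y + e 2%N y * -1) = 0.
  by rewrite (half_line_FTC cv dh d1 dF) /e expr1 !mul0r oppr0.
have -> : 3 / 2 * gauss_integral 0 (fun=> 1) = half_line_integral id (fun=> 1)
    (fun y => e 0%N y * (3 / 2) + (e 0%N y + e 2%N y * -1) * (3 / 2)) :> R.
  rewrite (half_line_integralD cv); [|exact: exp_decayZ..].
  rewrite (half_line_integralZ cv _ dh) E0 mul0r addr0.
  by rewrite (half_line_integralZ cv _ d0) mulrC.
have -> : 3 * gauss_integral 0 (cos_sqr (3 / 4)) + gauss_integral 0 (sin_sqr (3 / 4)) =
    half_line_integral id (fun=> 1) (fun y =>
      y ^+ 0 * expR (- (y ^+ 2 / 2)) * cos_sqr (3 / 4) y * 3 +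
      y ^+ 0 * expR (- (y ^+ 2 / 2)) * sin_sqr (3 / 4) y) :> R.
  rewrite (half_line_integralD cv)//; last exact: exp_decayZ.
  by rewrite (half_line_integralZ cv)// mulrC.
have bound (y : R) : 0 <= y ->
    e 0%N y * (3 / 2) + (e 0%N y + e 2%N y * -1) * (3 / 2) <=
    y ^+ 0 * expR (- (y ^+ 2 / 2)) * cos_sqr (3 / 4) y * 3 +
    y ^+ 0 * expR (- (y ^+ 2 / 2)) * sin_sqr (3 / 4) y.
  move=> y0; rewrite /e /cos_sqr /sin_sqr.
  have y20 : 0 <= 3 / 4 * (y ^+ 2 / 2) by rewrite mulr_ge0// divr_ge0// sqr_ge0.
  have := ler_wpM2l (expR_ge0 (- (y ^+ 2 / 2))) (trig_lower_bound y20).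
  by clear b1; lra.
apply: le_Rintegral => //.
- exact: (exp_decay_integrable cv
    (exp_decayD (exp_decayZ (3 / 2) d0) (exp_decayZ (3 / 2) dh))).
- apply: (exp_decay_integrable cv (exp_decayD (exp_decayZ 3 dc) ds)).
- by move=> y /=; rewrite in_itv/= andbT => y0; have := bound y y0; rewrite !mulr1.
Qed.

End gauss.

(** * The perturbed probability *)

Section density_probability.
Context d (T : measurableType d) (R : realType) (P : probability T R).

Lemma exists_density_probability (h : T -> R) :
  measurable_fun setT h -> (forall t, 0 <= h t) -> (\int[P]_t (h t)%:E = 1)%E ->
  exists Q : probability T R,
    forall A, measurable A -> Q A = (\int[P]_(t in A) (h t)%:E)%E.
Proof.
move=> mh h0 h1; pose Q A := (\int[P]_(t in A) (h t)%:E)%E.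
have Q0 : Q set0 = 0%E by rewrite /Q integral_set0.
have Qge0 A : (0 <= Q A)%E by apply: integral_ge0 => t _; rewrite lee_fin.
have Qsigma : semi_sigma_additive Q.
  move=> F mF tF mUF; rewrite /Q; apply: cvg_toP.
    apply: ereal_nondecreasing_is_cvgn => m n mn.
    by apply: lee_sum_nneg_natr => // k _ _; exact: Qge0.
  rewrite ge0_integral_bigcup//=.
    by apply: measurable_funTS; exact/measurable_EFinP.
  by move=> t _; rewrite lee_fin.
pose Qm := isMeasure.Build _ _ _ Q Q0 Qge0 Qsigma.
pose Qmeas : {measure set T -> \bar R} := HB.pack Q Qm.
pose Qp := @Measure_isProbability.Build _ _ _ Qmeas h1.
pose Qprob : probability T R := HB.pack Q Qm Qp.
by exists Qprob.
Qed.

End density_probability.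

Section twist.
Context d (T : measurableType d) (R : realType) (P : probability T R).
Variables X Y : {RV P >-> R}.
Hypothesis XY : independent_RVs X Y.
Hypothesis XE : same_law (distribution P X) (exponential_prob (1 : R)).
Hypothesis YE : same_law (distribution P Y) (normal_prob (0 : R) 1).

Local Notation Z := (fun t => X t * Y t).

Lemma product_moment k : P.-integrable setT (EFin \o (fun t => Z t ^+ k)).
Proof.
have c1 : continuous (fun _ : R => 1 : R) by exact: continuous_fun_cst.
have b1 (y : R) : `|1 : R| <= 1 by rewrite normr1.
have [iX _] := @exponential_moment _ _ _ _ X 0 k _ XE c1 b1.
have [iY _] := @normal_moment _ _ _ _ Y 0 k _ YE c1 b1 (fun=> erefl).
have [] := integral_indep XY _ _ iX iY; try exact: measurable_signed_monomial.
move=> + _; apply: eq_integrable => // t _ /=.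
by rewrite /signed_monomial !expr0 !mul1r !mulr1 exprMn.
Qed.

(** The phase is 3 * xi + 3/4 * u with u = eta^2/2, to match the substitution that
    evaluates the Gaussian moments. *)
Definition twist t := sin (3 * X t + 3 / 4 * (Y t ^+ 2 / 2)).

(** The addition formula splits the sine of the phase into products of a function
    of [X] and a function of [Y]. The case j = 1 gives the moments of Z against the
    perturbation, the case j = 2, k = 0 its effect on the sign of Z. *)
Lemma twisted_moment j k :
  P.-integrable setT (EFin \o (fun t => Num.sg (Z t) ^+ j * Z t ^+ k * twist t)) /\
  \int[P]_t (Num.sg (Z t) ^+ j * Z t ^+ k * twist t) =
  normal_peak 1 * (1 + (-1) ^+ (j + k)) *
    (cos_moment id (fun=> 1) 3 k * gauss_integral k (sin_sqr (3 / 4)) +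
     sin_moment id (fun=> 1) 3 k * gauss_integral k (cos_sqr (3 / 4))).
Proof.
have cc : continuous (fun x : R => cos (3 * x)).
  exact: continuous_fun_comp (@continuous_mulr_id _ 3) (@continuous_cos R).
have cs : continuous (fun x : R => sin (3 * x)).
  exact: continuous_fun_comp (@continuous_mulr_id _ 3) (@continuous_sin R).
have [iXc EXc] := exponential_moment j k XE cc (fun y => cos_max _).
have [iXs EXs] := exponential_moment j k XE cs (fun y => sin_max _).
have [iYc EYc] := normal_moment j k YE (@continuous_cos_sqr _ (3 / 4))
  (fun y => cos_max _) (fun y => congr1 (fun z => cos (3 / 4 * (z / 2))) (sqrrN y)).
have [iYs EYs] := normal_moment j k YE (@continuous_sin_sqr _ (3 / 4))
  (fun y => sin_max _) (fun y => congr1 (fun z => sin (3 / 4 * (z / 2))) (sqrrN y)).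
have mXc := measurable_signed_monomial j k cc.
have mXs := measurable_signed_monomial j k cs.
have mYc := measurable_signed_monomial j k (@continuous_cos_sqr R (3 / 4)).
have mYs := measurable_signed_monomial j k (@continuous_sin_sqr R (3 / 4)).
have [i1 E1] := integral_indep XY mXc mYs iXc iYs.
have [i2 E2] := integral_indep XY mXs mYc iXs iYc.
have E t : Num.sg (Z t) ^+ j * Z t ^+ k * twist t =
    signed_monomial j k (fun x : R => cos (3 * x)) (X t) *
      signed_monomial j k (sin_sqr (3 / 4)) (Y t) +
    signed_monomial j k (fun x : R => sin (3 * x)) (X t) *
      signed_monomial j k (cos_sqr (3 / 4)) (Y t).
  rewrite /twist /signed_monomial sinD sgrM !exprMn /cos_sqr /sin_sqr; ring.
split.
  by apply: eq_integrable (integrableD measurableT i1 i2) => // t _ /=; rewrite E.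
under eq_Rintegral do rewrite E.
rewrite RintegralD// E1 E2 EXc EXs EYc EYs /cos_moment /sin_moment.
by rewrite /cos_term /sin_term; ring.
Qed.

(** For even k the parity factor vanishes; for odd k the cancellation is
    [moment_cancellation] with w = 3 and v = 3/4. *)
Lemma twisted_moment_eq0 k : \int[P]_t (Num.sg (Z t) ^+ 1 * Z t ^+ k * twist t) = 0.
Proof.
have [_ ->] := twisted_moment 1 k.
rewrite -(odd_double_half k); case: (odd k) => /=; last first.
  by rewrite add0n add1n exprS -muln2 exprM sqrr_sign mulr1 subrr mulr0 mul0r.
rewrite add1n; set n := k./2.
rewrite gauss_integral_cos gauss_integral_sin.
have h : 3 / 4 * (3 ^+ 2 - 1) = 2 * 3 :> R by field.
have M := moment_cancellation n change_of_var_id change_of_var_sqr h.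
rewrite -[RHS](mulr0 (normal_peak 1 * (1 + (-1) ^+ n.*2.+2) * 2 ^+ n)) -M add1n.
ring.
Qed.

(** The moments of order 0 of the exponential variable are 1/10 and 3/10, and
    [gauss_integral_lower_bound] handles the normal one; its right-hand side is
    normalised by the total mass of the normal law. *)
Lemma twisted_sign_gt0 : 0 < \int[P]_t (Num.sg (Z t) ^+ 2 * Z t ^+ 0 * twist t).
Proof.
have [_ ->] := twisted_moment 2 0.
have c1 : continuous (fun _ : R => 1 : R) by exact: continuous_fun_cst.
have b1 (y : R) : `|1 : R| <= 1 by rewrite normr1.
have [_] := @normal_moment _ _ _ _ Y 0 0 _ YE c1 b1 (fun=> erefl).
under eq_Rintegral do rewrite /signed_monomial !expr0 !mulr1.
rewrite Rintegral_cst// mul1r.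
have P1 : 1 = fine (P [set: T]) by rewrite probability_setT.
move=> /(etrans P1); rewrite /= addn0 expr0 sqrrN expr1n => E.
rewrite (cos_moment0 change_of_var_id) (sin_moment0 change_of_var_id).
have B := @gauss_integral_lower_bound R.
have c0 : 0 <= normal_peak 1 :> R by exact: normal_peak_ge0.
have -> : 1 + 3 ^+ 2 = 10 :> R by ring.
have := ler_wpM2l c0 B; clear b1; lra.
Qed.

End twist.

(** * The product is moment indeterminate *)

Unset Implicit Arguments.

Theorem corollary4 (R : realType) (d : measure_display) (T : measurableType d)
    (P : probability T R) (xi eta : {RV P >-> R})
    (indep : independent_RVs xi eta)
    (xi_exp : same_law (distribution P xi) (exponential_prob (1 : R)))
    (eta_normal : same_law (distribution P eta) (normal_prob (0 : R) (1 : R))) :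
  M_indet (xi * eta : {RV P >-> R}).
Proof.
pose Z t := xi t * eta t.
have mZ : measurable_fun setT Z by exact: measurable_funM.
have iZ k := product_moment indep xi_exp eta_normal k.
have [iW EW] : (forall k, P.-integrable setT
      (EFin \o (fun t => Num.sg (Z t) ^+ 1 * Z t ^+ k * twist xi eta t))) /\
    (forall k, \int[P]_t (Num.sg (Z t) ^+ 1 * Z t ^+ k * twist xi eta t) = 0).
  split=> k; first by have [] := twisted_moment indep xi_exp eta_normal 1 k.
  exact: (twisted_moment_eq0 indep xi_exp eta_normal).
split=> [k _|[_ det]]; first exact: iZ.
pose g t := Num.sg (Z t) * twist xi eta t.
pose h t := 1 + g t.
have mtwist : measurable_fun setT (twist xi eta).
  apply: measurableT_comp; first exact: continuous_measurable (@continuous_sin R).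
  apply: measurable_funD; first exact: measurable_funM.
  apply: measurable_funM => //; apply: measurable_funM => //.
  exact: measurable_funX.
have msg : measurable_fun setT (fun t => Num.sg (Z t)).
  exact: measurableT_comp measurable_sgr mZ.
have mh : measurable_fun setT h.
  by apply: measurable_funD => //; exact: measurable_funM.
have sg1 t : `|Num.sg (Z t)| <= 1 by rewrite normr_sg; case: (_ == _).
have h0 t : 0 <= h t.
  have : `|g t| <= 1.
    by rewrite /g normrM -[leRHS]mulr1; apply: ler_pM => //; exact: sin_max.
  by rewrite /h ler_norml => /andP[]; lra.
have hE k t : Z t ^+ k * h t = Z t ^+ k + Num.sg (Z t) ^+ 1 * Z t ^+ k * twist xi eta t.
  by rewrite /h /g; ring.
have ih k : P.-integrable setT (EFin \o (fun t => Z t ^+ k * h t)).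
  apply: eq_integrable (integrableD measurableT (iZ k) (iW k)) => // t _ /=.
  by rewrite hE.
have eh k : (\int[P]_t (Z t ^+ k * h t)%:E = \int[P]_t (Z t ^+ k)%:E)%E.
  have fh := integrable_fin_num measurableT (ih k).
  have fZ := integrable_fin_num measurableT (iZ k).
  rewrite -[LHS](fineK fh) -[RHS](fineK fZ); congr EFin.
  have : \int[P]_t (Z t ^+ k * h t) = \int[P]_t (Z t ^+ k).
    under eq_Rintegral do rewrite hE.
    by rewrite RintegralD// EW addr0.
  exact.
have h1 : (\int[P]_t (h t)%:E = 1)%E.
  have := eh 0; under eq_integral do rewrite mul1r.
  move=> ->; rewrite (@integral_cst _ _ _ P _ measurableT 1) mul1e.
  exact: probability_setT.
have [Q QE] := exists_density_probability mh h0 h1.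
have mZ' : @measurable_fun _ _ T (measurableTypeR R) setT Z := mZ.
pose Z' : {mfun T >-> measurableTypeR R} :=
  HB.pack (Z : T -> measurableTypeR R) (isMeasurableFun.Build _ _ _ _ _ mZ').
have iQ k : Q.-integrable setT (EFin \o (fun t => Z t ^+ k)).
  have mZk : measurable_fun setT (fun t => Z t ^+ k) by exact: measurable_funX.
  exact: (integrable_density (mu := P) mh h0 QE mZk (ih k)).
(* If Z were moment determinate, the law of Z under Q would be its law
   under P, and then the sign of Z would have the same mean under both. *)
pose nu : probability (measurableTypeR R) R := distribution Q Z'.
have nu_law : same_law nu (distribution P (xi * eta : {RV P >-> R})).
  apply: det.
    move=> k _; apply: integrable_pushforward => //; last exact: iQ k.
    by apply/measurable_EFinP; exact: measurable_funX.
  move=> k _; rewrite /moment unlock.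
  transitivity (\int[Q]_t (Z t ^+ k)%:E)%E.
    apply: (@integral_distribution _ _ T (measurableTypeR R) R Q Z'
      (fun z : R => (z ^+ k)%:E)); last exact: iQ k.
    by apply/measurable_EFinP; exact: measurable_funX.
  rewrite (@integral_density _ _ _ P Q h)//; last first.
    by apply/measurable_EFinP; exact: measurable_funX.
  exact: eh.
have isg (M : probability T R) : M.-integrable setT (EFin \o (fun t => Num.sg (Z t))).
  apply: (@le_integrable _ _ _ M setT _ _ (cst 1%E)) => //.
  - exact/measurable_EFinP.
  - by move=> t _ /=; rewrite lee_fin normr1.
  - exact: finite_measure_integrable_cst.
have dist_sg (M : probability T R) :
    \int[distribution M Z']_z Num.sg z = \int[M]_t Num.sg (Z t).
  rewrite /Rintegral; congr fine.
  apply: (@integral_distribution _ _ T (measurableTypeR R) R M Z'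
    (fun z : R => (Num.sg z)%:E)); last exact: isg.
  by apply/measurable_EFinP; exact: measurable_sgr.
have QP : \int[Q]_t Num.sg (Z t) = \int[P]_t Num.sg (Z t).
  rewrite -!dist_sg /Rintegral; congr fine.
  by apply: eq_measure_integral => A mA _; exact: nu_law.
have [iW2 _] := twisted_moment indep xi_exp eta_normal 2 0.
(* The means of the sign differ by the expectation in [twisted_sign_gt0]. *)
have hsg : \int[P]_t (Num.sg (Z t) * h t) = \int[P]_t Num.sg (Z t) +
    \int[P]_t (Num.sg (Z t) ^+ 2 * Z t ^+ 0 * twist xi eta t).
  rewrite -(RintegralD measurableT (isg P) iW2).
  by apply: eq_Rintegral => t _; rewrite /h /g; ring.
have := twisted_sign_gt0 indep xi_exp eta_normal; rewrite -[X in 0 < X](addKr (\int[P]_t Num.sg (Z t))).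
by rewrite -hsg -(Rintegral_density (mu := P) mh h0 QE msg) QP addNr ltxx.
Qed.
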